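(* Let $A\in\mathbb{R}^{N\times N}$ be a Metzler matrix with $\mathbf 1=(1,\dots,1)^T\in\ker(A^T)$, and let $\alpha,\beta\in\mathbb{R}$ satisfy $0\le\alpha\le1$, $\beta>0$, $\alpha\beta+\frac1{2\beta}\le1$. Let $y^*\in\ker(A)\cap\mathbb{R}^N_{>0}$ be a positive steady state of $y'=Ay$. Then, for every $\Delta t>0$, $y^*$ is a fixed point of the SSPMPRK2($\alpha,\beta$) map $g$ with step size $\Delta t$ applied to $y'=Ay$, and the following holds: (a) If $\alpha>\frac1{2\beta}$, the stability region of the SSPMPRK2($\alpha,\beta$) method is bounded. (b) If $\alpha<\frac1{2\beta}$ and $(\alpha,\beta)\neq(0,\frac12)$, then $y^*$ is a (Lyapunov) stable fixed point of $g$ for all $\Delta t>0$. (c) If $\alpha=\frac1{2\beta}$ or $(\alpha,\beta)=(0,\frac12)$, and if all nonzero eigenvalues of $A$ have negative real part, then $y^*$ is a (Lyapunov) stable fixed point of $g$ for all $\Delta t>0$.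
   Context: $\mathbb{R}^N_{>0}$ is the set of vectors with all components positive. A Metzler matrix is a real square matrix with nonnegative off-diagonal entries. For $y\in\mathbb{R}^N_{>0}$ and $x\in\mathbb{R}$, $\operatorname{diag}(y)^x$ is the diagonal matrix with entries $y_i^x$. The scheme SSPMPRK2($\alpha,\beta$) applied to $y'=Ay$ with step size $\Delta t>0$ is the map $g:\mathbb{R}^N_{>0}\to\mathbb{R}^N_{>0}$, $y^n\mapsto y^{n+1}$, where $y^{(1)},y^{n+1}\in\mathbb{R}^N_{>0}$ are the unique solutions of the successive linear systems $$y^{(1)}=y^n+\beta\Delta t\,A\,y^{(1)},$$ $$y^{n+1}=(1-\alpha)y^n+\alpha y^{(1)}+\Delta t\,A\operatorname{diag}(y^{n+1})\operatorname{diag}(y^{(1)})^{-s}\operatorname{diag}(y^n)^{s-1}\bigl(\beta_{20}y^n+\beta_{21}y^{(1)}\bigr),$$ with $\beta_{20}=1-\frac1{2\beta}-\alpha\beta$, $\beta_{21}=\frac1{2\beta}$, $s=\frac{1-\alpha\beta+\alpha\beta^2}{\beta(1-\alpha\beta)}$. A fixed point $y^*$ of $y^{n+1}=g(y^n)$ is (Lyapunov) stable if for every $\epsilon>0$ there is $\delta>0$ such that $y^0\in\mathbb{R}^N_{>0}$ and $\|y^0-y^*\|<\delta$ imply $\|y^n-y^*\|<\epsilon$ for all $n\ge0$. The stability region of the method is the set $\{z\in\mathbb{C}\mid\operatorname{Re}(z)\le0,\ |R(z)|\le1\}$, where $$R(z)=\frac{-2+(2\alpha\beta^2-2\alpha\beta+1)z^2-2\beta(\alpha-1)z}{2\,(1+(\alpha\beta-1)z)(\beta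 z-1)}$$ is the stability function of the method (for an eigenvalue $\lambda$ of $A$, $R(\Delta t\lambda)$ is the corresponding eigenvalue of the Jacobian $Dg(y^* )$). *)

(* Defs.v *)
From mathcomp Require Import all_boot all_order all_algebra.
From mathcomp Require Import all_classical all_reals all_analysis.
From mathcomp Require Import complex.

Set Implicit Arguments.
Unset Strict Implicit.
Unset Printing Implicit Defensive.

Import Order.TTheory GRing.Theory Num.Theory numFieldNormedType.Exports.

Local Open Scope classical_set_scope.
Local Open Scope complex_scope.
Local Open Scope ring_scope.

Section Scheme.
Context {R : realType} {N : nat}.
Implicit Types (A : 'M[R]_N) (y z w : 'cV[R]_N) (g : 'cV[R]_N -> 'cV[R]_N).

Definition metzler A := forall i j, i != j -> 0 <= A i j.

Definition positive_vector y := forall i, 0 < y i 0.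

Definition diag_pow y (x : R) : 'M[R]_N := diag_mx (\row_i (y i 0 `^ x)).

(* The element of S if S is a singleton consisting of a positive vector, and
   the junk value 0 (which is not positive when 0 < N) otherwise. *)
Definition unique_positive_element (S : set 'cV[R]_N) : 'cV[R]_N :=
  xget 0 [set y | positive_vector y /\ S = [set y]].

Definition beta20 (alpha beta : R) : R := 1 - 1 / (2 * beta) - alpha * beta.

Definition beta21 (beta : R) : R := 1 / (2 * beta).

Definition sspmprk2_s (alpha beta : R) : R :=
  (1 - alpha * beta + alpha * beta ^+ 2) / (beta * (1 - alpha * beta)).

Definition sspmprk2_stage (beta : R) A (dt : R) y : 'cV[R]_N :=
  unique_positive_element [set w | w = y + (beta * dt) *: (A *m w)].

(* The unknown z enters through diag_mx z^T, i.e. diag(z), so that the system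
   is linear in z, also for z with nonpositive components. *)
Definition sspmprk2 (alpha beta : R) A (dt : R) y : 'cV[R]_N :=
  let y1 := sspmprk2_stage beta A dt y in
  let s := sspmprk2_s alpha beta in
  unique_positive_element
    [set z | z = (1 - alpha) *: y + alpha *: y1
       + dt *: (A *m diag_mx z^T *m diag_pow y1 (- s) *m diag_pow y (s - 1)
                *m (beta20 alpha beta *: y + beta21 beta *: y1))].

Definition lyapunov_stable g y :=
  forall eps : R, 0 < eps -> exists2 delta : R, 0 < delta &
    forall y0, positive_vector y0 -> `|y0 - y| < delta ->
      forall n, `|iter n g y0 - y| < eps.

Definition stable_fixed_point g y := g y = y /\ lyapunov_stable g y.

End Scheme.

Section Stability.
Context {R : realType}.

Definition stability_function (alpha beta : R) (z : R[i]) : R[i] :=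
  let a := alpha%:C in let b := beta%:C in
  (- 2 + (2 * a * b ^+ 2 - 2 * a * b + 1) * z ^+ 2 - 2 * b * (a - 1) * z)
  / (2 * (1 + (a * b - 1) * z) * (b * z - 1)).

(* R[i]^o is R[i] as a normed space over itself, as bounded_set requires. *)
Definition stability_region (alpha beta : R) : set R[i]^o :=
  [set z : R[i] | complex.Re z <= 0 /\ `|stability_function alpha beta z| <= 1].

Definition is_complex_eigenvalue (N : nat) (A : 'M[R]_N) (lambda : R[i]) : bool :=
  eigenvalue (map_mx (real_complex R) A) lambda.

End Stability.

(* Main.v *)
(* Write Z = dt A, a = 1 - alpha beta, b = beta, h = a + b - 1/2.  Since Z is
   Metzler with zero column sums and Z y* = 0, it is dissipative for the inner
   product <x, y> = sum_i x_i y_i / y*_i, by the Dirichlet form identity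
     <x, Z x> = - 1/2 sum_ij Z_ij y*_j (x_i / y*_i - x_j / y*_j)^2.
   The stability function is P / Q with P = 1 + (1 - a - b) z + (a b - h) z^2
   and Q = (1 - a z) (1 - b z), and |Q(Z) u|^2 - |P(Z) u|^2 equals
     - 2 <x, Z x> - g <Z u, Z^2 u> + h g |Z^2 u|^2,
   x = u - h Z u, g = 2 a b - h = 2 (a - 1/2) (b - 1/2).  For alpha beta <= 1/2
   one has g >= 0, so that R(Z) contracts strictly on the range of Z, which is a
   complement of the kernel of Z.  If y0 is in the kernel of Z, the step map
   Phi satisfies Phi(y) - y0 = R(Z) (y - y0) up to a small multiple of y - y0, and it
   preserves y0 + range Z.  Hence iterates starting near y* stay near the
   projection y0 of the initial value on the kernel of Z along the range of Z.
   If alpha beta > 1/2, then |R(z)| tends to |a b - h| / (a b) > 1 at infinity. *)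

Require Import Defs.
From mathcomp Require Import all_boot all_order all_algebra.
From mathcomp Require Import all_classical all_reals all_analysis.
From mathcomp Require Import complex ring lra.
Import Order.TTheory GRing.Theory Num.Theory numFieldNormedType.Exports.
Local Open Scope classical_set_scope.
Local Open Scope ring_scope.

(** * Cauchy-Schwarz and the inner product weighted by [1 / w] *)

Lemma sqr_sum_mul_le (R : realFieldType) (I : finType) (P : pred I) (p r : I -> R) :
  (forall i, P i -> 0 <= p i) ->
  (\sum_(i | P i) p i * r i) ^+ 2
  <= (\sum_(i | P i) p i) * (\sum_(i | P i) p i * r i ^+ 2).
Proof.
move=> p_ge0.
(* Lagrange's identity: this double sum is twice the gap between the two sides. *)
have : 0 <= \sum_(i | P i) \sum_(j | P j) p i * p j * (r i - r j) ^+ 2.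
  by do 2![apply: sumr_ge0 => ? ?]; rewrite mulr_ge0 ?sqr_ge0// mulr_ge0 ?p_ge0.
have -> : \sum_(i | P i) \sum_(j | P j) p i * p j * (r i - r j) ^+ 2 =
    \sum_(i | P i) \sum_(j | P j) (p i * r i ^+ 2) * p j
    + \sum_(i | P i) \sum_(j | P j) p i * (p j * r j ^+ 2)
    - 2 * \sum_(i | P i) \sum_(j | P j) (p i * r i) * (p j * r j).
  rewrite mulr_sumr -sumrN -!big_split; apply: eq_bigr => i _ /=.
  rewrite mulr_sumr -sumrN -!big_split; apply: eq_bigr => j _ /=; ring.
rewrite -!big_distrlr /= expr2; nra.
Qed.

Section WeightedForm.
Context {R : realType} {N : nat}.
Implicit Types (w x y z : 'cV[R]_N) (M A Z : 'M[R]_N).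

Definition dot w x y : R := \sum_i x i 0 * y i 0 / w i 0.

Lemma dotC w x y : dot w x y = dot w y x.
Proof. by apply: eq_bigr => i _; rewrite [x i 0 * _]mulrC. Qed.

Lemma dotDl w x y z : dot w (x + y) z = dot w x z + dot w y z.
Proof. by rewrite -big_split; apply: eq_bigr => i _; rewrite !mxE !mulrDl. Qed.

Lemma dotZl w k x z : dot w (k *: x) z = k * dot w x z.
Proof. by rewrite mulr_sumr; apply: eq_bigr => i _; rewrite !mxE !mulrA. Qed.

Lemma dotNl w x z : dot w (- x) z = - dot w x z.
Proof. by rewrite -scaleN1r dotZl mulN1r. Qed.

Lemma dotDr w x y z : dot w z (x + y) = dot w z x + dot w z y.
Proof. by rewrite dotC dotDl !(dotC w z). Qed.

Lemma dotZr w k x z : dot w z (k *: x) = k * dot w z x.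
Proof. by rewrite dotC dotZl dotC. Qed.

Lemma dotNr w x z : dot w z (- x) = - dot w z x.
Proof. by rewrite dotC dotNl dotC. Qed.

Definition dotE := (dotDl, dotDr, dotNl, dotNr, dotZl, dotZr).

Definition sqn w x : R := dot w x x.

Section Positive.
Variable w : 'cV[R]_N.
Hypothesis w_gt0 : positive_vector w.

Lemma sqn_ge0 x : 0 <= sqn w x.
Proof. by apply: sumr_ge0 => i _; rewrite divr_ge0 ?(ltW (w_gt0 i))// -expr2 sqr_ge0. Qed.

Lemma sqr_coord_le_sqn x i : x i 0 ^+ 2 / w i 0 <= sqn w x.
Proof.
rewrite /sqn /dot (bigD1 i)//= -expr2 lerDl; apply: sumr_ge0 => j _.
by rewrite divr_ge0 ?(ltW (w_gt0 j))// -expr2 sqr_ge0.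
Qed.

Lemma sqn_le0 x : sqn w x <= 0 -> x = 0.
Proof.
move=> x0; apply/matrixP => i j; rewrite ord1 mxE.
have := le_trans (sqr_coord_le_sqn x i) x0.
rewrite ler_pdivrMr// mul0r => xi0; apply/eqP; rewrite -sqrf_eq0 eq_le xi0 /=.
by rewrite sqr_ge0.
Qed.

Lemma sqn0 : sqn w 0 = 0.
Proof. by rewrite /sqn -[X in dot w X _](scale0r 0) dotZl mul0r. Qed.

Lemma sqnN x : sqn w (- x) = sqn w x.
Proof. by rewrite /sqn !dotE opprK. Qed.

Lemma sqnZ k x : sqn w (k *: x) = k ^+ 2 * sqn w x.
Proof. by rewrite /sqn !dotE mulrA. Qed.

(** Expand [sqn w (t *: x - y)], which is nonnegative, and divide by [t]. The free [t] lets the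
    factor of [sqn w x] come as close to 1 as desired. *)
Lemma sqnD_le t x y : 0 < t ->
  sqn w (x + y) <= (1 + t) * sqn w x + (1 + t^-1) * sqn w y.
Proof.
move=> t0; have := sqn_ge0 (t *: x - y).
rewrite /sqn !dotE (dotC w y x) => h.
have : 0 <= t^-1 * (t * (t * dot w x x) - 2 * (t * dot w x y) + dot w y y).
  by rewrite mulr_ge0 ?invr_ge0 ?(ltW t0)//; lra.
have -> : t^-1 * (t * (t * dot w x x) - 2 * (t * dot w x y) + dot w y y)
   = t * dot w x x - 2 * dot w x y + t^-1 * dot w y y.
  by field; rewrite gt_eqF.
lra.
Qed.

Lemma sqnD_le2 x y : sqn w (x + y) <= 2 * (sqn w x + sqn w y).
Proof. have := sqnD_le 1 x y ltr01; rewrite invr1; lra. Qed.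

Lemma sqn_le_coord K x y :
  (forall i, `|x i 0| <= K * `|y i 0|) -> sqn w x <= K ^+ 2 * sqn w y.
Proof.
move=> xy; rewrite mulr_sumr; apply: ler_sum => i _.
rewrite [leRHS]mulrA -!expr2 ler_pM2r ?invr_gt0//.
have := xy i; rewrite -[x i 0 ^+ 2]real_normK ?num_real//.
rewrite -[y i 0 ^+ 2]real_normK ?num_real// -exprMn => h.
by rewrite lerXn2r// nnegrE ?(le_trans _ h).
Qed.

Lemma sqn_mulmx_le M : exists2 K, 0 <= K & forall x, sqn w (M *m x) <= K * sqn w x.
Proof.
exists (\sum_i ((\sum_j w j 0) / w i 0) * (\sum_j M i j ^+ 2)).
  apply: sumr_ge0 => i _; apply: mulr_ge0.
    by rewrite divr_ge0 ?(ltW (w_gt0 i))//; apply: sumr_ge0 => j _; exact: ltW.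
  by apply: sumr_ge0 => j _; rewrite sqr_ge0.
move=> x; rewrite mulr_suml; apply: ler_sum => i _.
rewrite -expr2 mxE.
have -> : \sum_j M i j * x j 0 = \sum_j w j 0 * (M i j * (x j 0 / w j 0)).
  by apply: eq_bigr => j _; field; rewrite gt_eqF.
have h := @sqr_sum_mul_le R _ predT (fun j => w j 0)
  (fun j => M i j * (x j 0 / w j 0)) (fun j _ => ltW (w_gt0 j)).
rewrite ler_pdivrMr//; apply: le_trans h _.
set W := \sum_j w j 0; set B := \sum_j M i j ^+ 2.
have -> : W / w i 0 * B * sqn w x * w i 0 = W * (B * sqn w x).
  by field; rewrite gt_eqF.
apply: ler_wpM2l; first by apply: sumr_ge0 => j _; exact: ltW.
rewrite mulr_suml; apply: ler_sum => j _.
have -> : w j 0 * (M i j * (x j 0 / w j 0)) ^+ 2 = M i j ^+ 2 * (x j 0 ^+ 2 / w j 0).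
  by field; rewrite gt_eqF.
by apply: ler_wpM2l; rewrite ?sqr_ge0// sqr_coord_le_sqn.
Qed.

(** Turns smallness in the weighted norm into closeness relative to each [w i 0], the form in which
    the Patankar weights are estimated. It works because [S] bounds every [1 / w i 0]. *)
Lemma sqn_near : exists2 mu, 0 < mu & forall r x, 0 <= r ->
  sqn w x <= mu * r ^+ 2 -> forall i, `|x i 0| <= r * w i 0.
Proof.
pose S := 1 + \sum_i (w i 0)^-1.
have S_gt0 : 0 < S.
  by rewrite ltr_pwDl// sumr_ge0// => i _; rewrite invr_ge0 ltW.
exists S^-1 => [|r x r0 xr i]; first by rewrite invr_gt0.
have wi := w_gt0 i.
have wS : 1 <= w i 0 * S.
  rewrite -[leLHS](divff (lt0r_neq0 wi)) ler_pM2l// /S (bigD1 i)//= addrCA lerDl.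
  by rewrite addr_ge0// sumr_ge0// => j _; rewrite invr_ge0 ltW.
rewrite -[X in _ <= X]ger0_norm ?mulr_ge0 ?(ltW wi)//.
rewrite -ler_sqr ?nnegrE// !real_normK ?num_real//.
have := le_trans (sqr_coord_le_sqn x i) xr.
rewrite ler_pdivrMr// => /le_trans; apply.
have Sw : S^-1 <= w i 0 by rewrite -[leLHS]mul1r ler_pdivrMr.
have -> : S^-1 * r ^+ 2 * w i 0 = r ^+ 2 * w i 0 * S^-1 by ring.
by rewrite exprMn [w i 0 ^+ 2]expr2 mulrA ler_wpM2l// mulr_ge0 ?sqr_ge0// ltW.
Qed.

Lemma near_gt0 r x : r <= 1 / 2 -> (forall i, `|x i 0 - w i 0| <= r * w i 0) ->
  positive_vector x.
Proof.
move=> r2 h i; have := h i; rewrite ler_norml => /andP[+ _].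
have wi := w_gt0 i; nra.
Qed.

Lemma coord_le_norm x i : `|x i 0| <= `|x|.
Proof.
rewrite [leRHS]/Num.norm /= mx_normrE; apply/bigmax_geP; right => /=.
by exists (i, 0).
Qed.

Lemma sqn_le_norm : exists2 K, 0 <= K & forall x, sqn w x <= K * `|x| ^+ 2.
Proof.
exists (\sum_i (w i 0)^-1) => [|x].
  by apply: sumr_ge0 => i _; rewrite invr_ge0 ltW.
rewrite mulr_suml; apply: ler_sum => i _.
rewrite mulrC -expr2 ler_wpM2l ?invr_ge0 ?(ltW (w_gt0 i))//.
by rewrite -[leLHS]real_normK ?num_real// lerXn2r ?nnegrE// coord_le_norm.
Qed.

Lemma norm_lt_sqn eps : 0 < eps ->
  exists2 nu, 0 < nu & forall x, sqn w x <= nu -> `|x| < eps.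
Proof.
move=> eps0; pose W := 1 + \sum_i w i 0.
have W0 : 0 < W by rewrite ltr_pwDl// sumr_ge0// => i _; rewrite ltW.
exists (eps ^+ 2 / (2 * W)) => [|x xnu].
  by rewrite divr_gt0 ?exprn_gt0// mulr_gt0.
rewrite [ltLHS]/Num.norm /= mx_normrE; apply/bigmax_ltP; split=> // -[i j] _ /=.
rewrite (ord1 j) -ltr_sqr ?nnegrE ?(ltW eps0)// real_normK ?num_real//.
have := le_trans (sqr_coord_le_sqn x i) xnu.
rewrite ler_pdivrMr// => /le_lt_trans; apply.
have wW : w i 0 <= W.
  by rewrite /W (bigD1 i)//= addrCA lerDl addr_ge0// sumr_ge0// => l _; exact: ltW.
have e2 : 0 < eps ^+ 2 by rewrite exprn_gt0.
rewrite mulrAC ltr_pdivrMr ?mulr_gt0// ltr_pM2l//; lra.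
Qed.

(** * Dissipativity of a conservative Metzler matrix *)

Section Dissipative.
Variable Z : 'M[R]_N.
Hypothesis Z_metzler : metzler Z.
Hypothesis Z_conservative : Z^T *m (const_mx 1 : 'cV[R]_N) = 0.
Hypothesis Zw : Z *m w = 0.

(** When the square is expanded, the terms in [x j 0 ^+ 2] cancel because the columns of [Z] sum to
    zero, those in [x i 0 ^+ 2] because [Z *m w = 0]; the mixed terms remain. *)
Lemma dirichletE x :
  \sum_i \sum_j Z i j * w j 0 * (x j 0 / w j 0 - x i 0 / w i 0) ^+ 2
  = - 2 * dot w x (Z *m x).
Proof.
have rowZ i : \sum_j Z i j * w j 0 = 0.
  by have := congr1 (fun y : 'cV[R]_N => y i 0) Zw; rewrite !mxE.
have colZ j : \sum_i Z i j = 0.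
  have := congr1 (fun y : 'cV[R]_N => y j 0) Z_conservative; rewrite !mxE => e; rewrite -[RHS]e.
  by apply: eq_bigr => i _; rewrite !mxE mulr1.
transitivity (\sum_i \sum_j Z i j * (x j 0 ^+ 2 / w j 0)
    + \sum_i (x i 0 / w i 0) ^+ 2 * \sum_j Z i j * w j 0
    - 2 * \sum_i x i 0 / w i 0 * (\sum_j Z i j * x j 0)).
  rewrite mulr_sumr -sumrN -!big_split; apply: eq_bigr => i _ /=.
  rewrite !mulr_sumr -sumrN -!big_split; apply: eq_bigr => j _ /=.
  by field; rewrite !gt_eqF.
rewrite exchange_big/= big1 ?add0r; last first.
  by move=> j _; rewrite -mulr_suml colZ mul0r.
rewrite big1 ?add0r; last by move=> i _; rewrite rowZ mulr0.
rewrite mulNr; congr (- (2 * _)); apply: eq_bigr => i _.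
by rewrite mxE mulrAC.
Qed.

(** Each entry of [Z *m x] is a combination of the differences in the Dirichlet form, with
    nonnegative weights, so Cauchy-Schwarz bounds its square by the corresponding part of that
    form. *)
Lemma dissipative_coercive :
  exists2 k, 0 < k & forall x, k * sqn w (Z *m x) <= - dot w x (Z *m x).
Proof.
set m := fun i => \sum_(j | i != j) Z i j * w j 0 / w i 0.
have m_ge0 i : 0 <= m i.
  by apply: sumr_ge0 => j ij; rewrite divr_ge0 ?(ltW (w_gt0 i))// mulr_ge0 ?Z_metzler// ltW.
set S := 1 + \sum_i m i.
have S_gt0 : 0 < S by rewrite ltr_pwDl// sumr_ge0.
have mS i : m i <= S.
  rewrite /S (bigD1 i)//= addrCA lerDl addr_ge0// sumr_ge0 => //.
exists (2 * S)^-1; first by rewrite invr_gt0 mulr_gt0.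
move=> x; rewrite ler_pdivrMl ?mulr_gt0//.
suff : sqn w (Z *m x) <= S * (- 2 * dot w x (Z *m x)) by lra.
rewrite -dirichletE mulr_sumr; apply: ler_sum => i _.
have rowZ : \sum_j Z i j * w j 0 = 0.
  by have := congr1 (fun y : 'cV[R]_N => y i 0) Zw; rewrite !mxE.
pose r j := x j 0 / w j 0 - x i 0 / w i 0.
(* Since [Z *m w = 0], subtracting [x i 0 / w i 0] changes nothing but kills the diagonal term, the
   only one whose weight may be negative. *)
have -> : (Z *m x) i 0 = \sum_(j | i != j) Z i j * w j 0 * r j.
  transitivity (\sum_j Z i j * w j 0 * r j).
    have e : (\sum_j Z i j * w j 0) * (x i 0 / w i 0) = 0 by rewrite rowZ mul0r.
    rewrite mxE -[LHS]subr0 -[X in _ - X = _]e mulr_suml -sumrB.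
    by apply: eq_bigr => j _; rewrite /r; field; rewrite !gt_eqF.
  rewrite (bigD1 i)//= /r subrr mulr0 add0r; apply: eq_bigl => j.
  by rewrite eq_sym.
rewrite -expr2 -[X in _ <= S * X]/(\sum_j Z i j * w j 0 * r j ^+ 2).
have -> : \sum_j Z i j * w j 0 * r j ^+ 2
        = \sum_(j | i != j) Z i j * w j 0 * r j ^+ 2.
  rewrite (bigD1 i)//= /r subrr expr0n/= mulr0 add0r; apply: eq_bigl => j.
  by rewrite eq_sym.
have h := @sqr_sum_mul_le R _ (fun j => i != j) (fun j => Z i j * w j 0) r
  (fun j ij => mulr_ge0 (Z_metzler i j ij) (ltW (w_gt0 j))).
rewrite ler_pdivrMr//; apply: le_trans h _.
have -> : \sum_(j | i != j) Z i j * w j 0 = m i * w i 0.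
  by rewrite mulr_suml; apply: eq_bigr => j _; rewrite divfK ?gt_eqF.
rewrite mulrAC ler_pM2r//; apply: ler_wpM2r => //; apply: sumr_ge0 => j ij.
by rewrite mulr_ge0 ?sqr_ge0// mulr_ge0 ?Z_metzler// ltW.
Qed.

(** The cross term [- 2 * k * dot w x (Z *m x)] is nonnegative by dissipativity. This gives both
    injectivity of [1 - k Z] and a bound on its inverse. *)
Lemma sqn_resolvent k x : 0 <= k -> sqn w x <= sqn w (x - k *: (Z *m x)).
Proof.
move=> k0; have [c c0 /(_ x) hc] := dissipative_coercive.
have := sqn_ge0 (Z *m x).
rewrite /sqn !dotE (dotC w (Z *m x) x) -/(sqn w (Z *m x)) => z0.
have : 0 <= k * (- dot w x (Z *m x)).
  by rewrite mulr_ge0// (le_trans _ hc)// mulr_ge0 ?(ltW c0).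
have : 0 <= k * (k * sqn w (Z *m x)) by rewrite !mulr_ge0.
lra.
Qed.

(* Coercivity at t - l Z t, on which Z takes the value Z t, for the l that makes
   the right-hand side vanish. *)
Lemma mulmx_sqr_eq0 (t : 'cV[R]_N) : Z *m (Z *m t) = 0 -> Z *m t = 0.
Proof.
set x := Z *m t => Zx; apply: sqn_le0; have [c c0 hc] := dissipative_coercive.
have [//|x0] := leP (sqn w x) 0.
have := hc (t - (dot w t x / sqn w x) *: x).
rewrite mulmxBr -scalemxAr Zx scaler0 subr0 -/x !dotE -/(sqn w x).
by rewrite divfK ?gt_eqF// subrr oppr0 pmulr_rle0// leNgt x0.
Qed.

(** Range and kernel of [Z] meet only in 0, so [Z] and its square have the same rank, hence the same
    row space and the same column space. [B] recovers a vector of the range from its image under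
    [Z]. *)
Lemma mulmx_sqr_factor :
  (exists B : 'M[R]_N, Z = B *m (Z *m Z)) /\ (exists C : 'M[R]_N, Z = Z *m Z *m C).
Proof.
have rk : \rank (Z^T *m Z^T) = \rank Z^T.
  rewrite -[RHS](mxrank_mul_ker Z^T Z^T) [X in (_ + X)%N](_ : _ = 0%N) ?addn0//.
  apply/eqP; rewrite mxrank_eq0; apply/rowV0P => v; rewrite sub_capmx.
  case/andP=> /submxP[t ->] /sub_kermxP tZZ.
  apply: trmx_inj; rewrite trmx0 trmx_mul trmxK mulmx_sqr_eq0//.
  by have := congr1 trmx tZZ; rewrite !trmx_mul !trmxK trmx0.
have sub (M : 'M[R]_N) : \rank (M *m M) = \rank M -> (M <= M *m M)%MS.
  by move=> e; rewrite -(mxrank_leqif_sup (submxMl M M)) e.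
split.
  apply/submxP/sub; rewrite -mxrank_tr trmx_mul rk; exact: mxrank_tr.
have /submxP[D eD] := sub _ rk.
by exists D^T; apply: trmx_inj; rewrite !trmx_mul trmxK.
Qed.

(** * Energy identity and strict contraction on the range *)

Lemma stability_energyE (a b : R) u :
  let h := a + b - 1 / 2 in
  let v := Z *m u in
  sqn w (u - (a + b) *: v + (a * b) *: (Z *m v))
  - sqn w (u + (1 - a - b) *: v + (a * b - (a + b) + 1 / 2) *: (Z *m v))
  = - 2 * dot w (u - h *: v) (Z *m (u - h *: v))
    - (2 * (a * b) - h) * dot w v (Z *m v)
    + h * (2 * (a * b) - h) * sqn w (Z *m v).
Proof.
(* On the left, [dot w v v] and [dot w u (Z *m v)] both have coefficient [2 * h], so the form at
   [u - h *: v] absorbs both. *)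
move=> h v; rewrite /sqn mulmxBr -!scalemxAr -/v !dotE.
rewrite (dotC w v u) (dotC w (Z *m v) u) (dotC w (Z *m v) v) /h.
by field.
Qed.

(** By coercivity the energy drop is at least [2 * k * sqn w (Z *m u)]. On the range of [Z],
    [u = B *m (Z *m u)], so this is a fixed fraction of the energy of Q(Z) u. *)
Lemma stability_contraction (a b : R) :
  0 <= a + b - 1 / 2 -> 0 <= 2 * (a * b) - (a + b - 1 / 2) ->
  exists2 rho, 0 <= rho < 1 & forall t u, u = Z *m t ->
    sqn w (u + (1 - a - b) *: (Z *m u)
           + (a * b - (a + b) + 1 / 2) *: (Z *m (Z *m u)))
    <= rho * sqn w (u - (a + b) *: (Z *m u) + (a * b) *: (Z *m (Z *m u))).
Proof.
move=> h0 g0; have [k k0 hk] := dissipative_coercive.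
have [[B ZB] _] := mulmx_sqr_factor.
have [KB KB0 hB] := sqn_mulmx_le B.
have [KQ KQ0 hQ] := sqn_mulmx_le (1%:M - (a + b) *: Z + (a * b) *: (Z *m Z)).
have K0 : 0 < KQ * KB + 1 + 2 * k by rewrite ltr_wpDl ?mulr_gt0// addr_ge0// mulr_ge0.
exists (1 - 2 * k / (KQ * KB + 1 + 2 * k)).
  apply/andP; split; last by rewrite gtrBl divr_gt0 ?mulr_gt0.
  by rewrite subr_ge0 ler_pdivrMr// mul1r lerDr addr_ge0// mulr_ge0.
move=> t u uE; have := stability_energyE a b u; cbv zeta.
set Qu := u - _ + _; set Pu := u + _ + _; set h := a + b - 1 / 2 in h0 g0 *.
move=> E.
have uB : u = B *m (Z *m u) by rewrite uE {1}ZB -!mulmxA.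
have QK : sqn w Qu <= KQ * KB * sqn w (Z *m u).
  have -> : Qu = (1%:M - (a + b) *: Z + (a * b) *: (Z *m Z)) *m u.
    by rewrite mulmxDl mulmxBl mul1mx -!scalemxAl -mulmxA.
  apply: le_trans (hQ _) _; rewrite -mulrA ler_wpM2l// {1}uB; exact: hB.
have low : 2 * k * sqn w (Z *m u) <= sqn w Qu - sqn w Pu.
  have h1 := hk (u - h *: (Z *m u)).
  have h2 := hk (Z *m u).
  (* Passes from the image of [u - h *: (Z *m u)], where coercivity is applied, to [Z *m u]. *)
  have h3 := sqn_resolvent h (Z *m u) h0.
  rewrite E; set D1 := dot w _ (Z *m (u - _)) in h1 *; set D2 := dot w _ _ in h2 *.
  have h4 : 0 <= (2 * (a * b) - h) * - D2.
    by rewrite mulr_ge0// (le_trans _ h2)// mulr_ge0 ?(ltW k0)// sqn_ge0.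
  have h5 : 0 <= h * (2 * (a * b) - h) * sqn w (Z *m (Z *m u)).
    by rewrite !mulr_ge0// sqn_ge0.
  have h6 : k * sqn w (Z *m u) <= k * sqn w (Z *m (u - h *: (Z *m u))).
    by rewrite ler_pM2l// mulmxBr -scalemxAr.
  lra.
have Zu0 := sqn_ge0 (Z *m u); have Qu0 := sqn_ge0 Qu.
rewrite mulrBl mul1r lerBrDl -lerBrDr; apply: le_trans low.
rewrite mulrAC ler_pdivrMr// -[leRHS]mulrA ler_pM2l ?mulr_gt0//.
nra.
Qed.

End Dissipative.
End Positive.
End WeightedForm.

(** * Linearization of the Patankar weights *)

Lemma is_derive_linear_approx (R : realType) (f : R -> R) (x k : R) :
  is_derive x 1 f k -> forall eta, 0 < eta -> exists2 r, 0 < r &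
  forall q, `|q - x| < r -> `|f q - f x - k * (q - x)| <= eta * `|q - x|.
Proof.
move=> [fd fk] eta eta0.
have : h^-1 *: (f (h + x) - f x) @[h --> 0^'] --> k.
  by rewrite -fk; have := fd; rewrite /derivable /derive;
    under [X in X @ _]eq_fun do rewrite /= -[_ *: 1]/(_ * 1) mulr1.
move/cvgrPdist_le => /(_ _ eta0); rewrite near_withinE.
case/nbhs_ballP=> r /= r0 hr; exists r => // q qx.
have [->|neq] := eqVneq q x; first by rewrite !subrr mulr0 subr0 normr0 mulr0.
have := hr (q - x); rewrite /ball/= sub0r normrN subrK => /(_ qx).
rewrite subr_eq0 => /(_ neq) H.
have q0 : q - x != 0 by rewrite subr_eq0.
have -> : f q - f x - k * (q - x) = - (k - (q - x)^-1 * (f q - f x)) * (q - x).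
  by field.
by rewrite normrM normrN ler_wpM2r.
Qed.

(* The weight d is homogeneous of degree 0, i.e. a function of t1 / t alone,
   with value a and derivative k at 1; hence r does not depend on m. *)
Lemma patankar_weight_estimate (R : realType) (s b0 b1 a k eta : R) :
  b0 + b1 = a -> b1 - s * a = k -> 0 < eta ->
  exists2 r, 0 < r <= 1 / 2 & forall m t0 t t1, 0 < m ->
    `|t0 - m| <= r * m -> `|t - m| <= r * m -> `|t1 - m| <= r * m ->
    let d := t1 `^ (- s) * (t `^ (s - 1) * (b0 * t + b1 * t1)) in
    `|d - a| <= eta /\ `|(d - a) * t0 - k * (t1 - t)| <= eta * `|t1 - t|.
Proof.
move=> b01 b1k eta0; pose psi q := q `^ (- s) * (b0 + b1 * q).
have psi1 : psi 1 = a by rewrite /psi powR1 mul1r mulr1.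
have dpsi : is_derive (1 : R) 1 psi k.
  have d1 := @is_derive1_powR R (- s) 1 ltr01.
  have := @is_deriveM R R _ (fun q : R => b0 + b1 * q) 1 1 _ b1 d1.
  have d2 : is_derive (1 : R) 1 (fun q : R => b0 + b1 * q) b1.
    by apply: is_derive_eq; rewrite add0r mul1r /GRing.scale/= mulr1.
  move=> /(_ d2) H; apply: is_derive_eq; rewrite !powR1 -b1k -b01.
  rewrite /GRing.scale /=; ring.
have [r r0 hr] := is_derive_linear_approx R psi 1 k dpsi (eta / 8) ltac:(by lra).
have k0 := normr_ge0 k.
pose D := 1 + `|k| + eta.
have D0 : 0 < D by rewrite /D; lra.
(* The three bounds keep [t] and [t1] positive, keep [q = t1 / t] within [r] of 1 (as [4 * rr < r]),
   and make the slope terms small against [eta]. *)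
pose rr := Num.min (1 / 2) (Num.min (r / 5) (eta / (8 * D))).
have [r1 [r2 r3]] : rr <= 1 / 2 /\ rr <= r / 5 /\ rr * (8 * D) <= eta.
  rewrite -ler_pdivlMr ?mulr_gt0// /rr !ge_min !lexx /=; do ! split => //;
  by rewrite ?orbT.
have rr0 : 0 < rr.
  by rewrite /rr !lt_min !divr_gt0// ?mulr_gt0.
exists rr; first by rewrite rr0.
move=> m t0 t t1 m0 h0 h h1 d.
have rm : rr * m <= m / 2 by nra.
have [t_lo t_hi] : m / 2 <= t /\ t <= 3 * m / 2.
  by move: (h); rewrite ler_norml => /andP[]; lra.
have t_gt0 : 0 < t by lra.
have t1_gt0 : 0 < t1 by move: (h1); rewrite ler_norml => /andP[]; lra.
pose q := t1 / t.
have t1E : t1 = q * t by rewrite /q divfK ?gt_eqF.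
have q_gt0 : 0 < q by rewrite divr_gt0.
have dE : d = psi q.
  rewrite /d t1E /psi powRM ?(ltW q_gt0) ?(ltW t_gt0)// -mulrA; congr (_ * _).
  rewrite mulrA -powRD; last by rewrite (gt_eqF t_gt0) implybT.
  rewrite addKr powR_inv1 ?(ltW t_gt0)//.
  by field; rewrite gt_eqF.
have tt1 : `|t1 - t| <= 2 * rr * m.
  by move: h h1; rewrite !ler_norml => /andP[? ?] /andP[? ?]; apply/andP; split; lra.
have q1 : `|q - 1| * t = `|t1 - t|.
  by rewrite -[X in _ * X]gtr0_norm// -normrM mulrBl mul1r -t1E.
have n0 := normr_ge0 (q - 1).
have q1r : `|q - 1| <= 4 * rr.
  rewrite -(ler_pM2r t_gt0) q1; nra.
have hq := hr q ltac:(by lra).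
rewrite dE; rewrite psi1 in hq.
have kq : `|k * (q - 1)| = `|k| * `|q - 1| by rewrite normrM.
split.
  have -> : psi q - a = (psi q - a - k * (q - 1)) + k * (q - 1) by ring.
  apply: le_trans (ler_normD _ _) _; rewrite kq.
  have : `|q - 1| * (`|k| + eta / 8) <= 4 * rr * D by rewrite ler_pM// /D; lra.
  lra.
(* Taylor remainder of [psi], plus the error of replacing [t] by [t0] in the slope term. *)
have -> : (psi q - a) * t0 - k * (t1 - t)
  = (psi q - a - k * (q - 1)) * t0 + k * (q - 1) * (t0 - t) by rewrite t1E; ring.
apply: le_trans (ler_normD _ _) _; rewrite normrM [X in _ + X]normrM kq.
have t0b : `|t0| <= 3 * m / 2.
  by move: h0; rewrite !ler_norml => /andP[? ?]; apply/andP; split; lra.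
have t0t : `|t0 - t| <= 2 * rr * m.
  by move: h h0; rewrite !ler_norml => /andP[? ?] /andP[? ?]; apply/andP; split; lra.
have A1 : `|psi q - a - k * (q - 1)| * `|t0| <= eta / 8 * `|q - 1| * (3 * m / 2).
  by apply: ler_pM.
have A2 : `|k| * `|q - 1| * `|t0 - t| <= `|k| * `|q - 1| * (2 * rr * m).
  by apply: ler_wpM2l => //; apply: mulr_ge0.
rewrite -q1.
have A3 : `|k| * rr <= eta / 8 by rewrite /D in r3; nra.
have A4 : `|q - 1| * m * (`|k| * rr) <= `|q - 1| * m * (eta / 8).
  by rewrite ler_wpM2l// mulr_ge0// ltW.
have A5 : eta * `|q - 1| * (m / 2) <= eta * `|q - 1| * t.
  by rewrite ler_wpM2l// mulr_ge0// ltW.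
have A6 : 0 <= eta * `|q - 1| * m by rewrite !mulr_ge0// ltW.
lra.
Qed.

(** * Unique solvability of the linear systems *)

Lemma unitmx_injective (F : fieldType) n (M : 'M[F]_n) :
  (forall x : 'cV_n, M *m x = 0 -> x = 0) -> M \in unitmx.
Proof.
move=> M_inj; rewrite -unitmx_tr -row_free_unit -kermx_eq0; apply/rowV0P => v.
move=> /sub_kermxP vM; apply: trmx_inj; rewrite trmx0; apply: M_inj.
by have := congr1 trmx vM; rewrite trmx_mul trmxK trmx0.
Qed.

Lemma unique_positive_elementE (R : realType) N (S : set 'cV[R]_N) z :
  positive_vector z -> S z -> (forall x, S x -> x = z) ->
  unique_positive_element S = z.
Proof.
move=> z_gt0 Sz uniq; apply: xget_unique => /=.
  by split=> //; apply/seteqP; split=> x /= => [/uniq//|->].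
by move=> y [_ S1]; apply/esym; move: Sz; rewrite S1.
Qed.

(** * One step of the scheme near a steady state *)

Section StepMap.
Context {R : realType} {N : nat}.
Variables (w : 'cV[R]_N) (A : 'M[R]_N) (dt alpha beta : R).
Hypothesis w_gt0 : positive_vector w.
Hypothesis A_metzler : metzler A.
Hypothesis A_conservative : A^T *m (const_mx 1 : 'cV[R]_N) = 0.
Hypothesis Aw : A *m w = 0.
Hypothesis dt_gt0 : 0 < dt.
Hypothesis alpha_ge0 : 0 <= alpha.
Hypothesis beta_gt0 : 0 < beta.
Hypothesis alpha_beta : alpha * beta + 1 / (2 * beta) <= 1.
Implicit Types (x y z : 'cV[R]_N).

Let Z := dt *: A.
Let s := sspmprk2_s alpha beta.
Let a := 1 - alpha * beta.
Let c := a * beta - (a + beta) + 1 / 2.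

Let Z_metzler : metzler Z.
Proof. by move=> i j ij; rewrite mxE mulr_ge0 ?A_metzler// ltW. Qed.

Let Z_conservative : Z^T *m (const_mx 1 : 'cV[R]_N) = 0.
Proof. by rewrite linearZ /= -scalemxAl A_conservative scaler0. Qed.

Let Zw : Z *m w = 0.
Proof. by rewrite -scalemxAl Aw scaler0. Qed.

Let a_gt0 : 0 < a.
Proof.
have : 0 < 1 / (2 * beta) by rewrite divr_gt0// mulr_gt0.
rewrite /a subr_gt0 => p0; by apply: lt_le_trans alpha_beta; rewrite ltrDl.
Qed.

Let sqn_leZ := @sqn_resolvent _ _ w w_gt0 Z Z_metzler Z_conservative Zw.

Definition hadamard x y : 'cV[R]_N := \col_i (x i 0 * y i 0).

Lemma mul_diag_col x y : diag_mx x^T *m y = hadamard x y.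
Proof. by apply/matrixP => i j; rewrite mul_diag_mx !mxE (ord1 j). Qed.

(** Gathers the powers and the combination of stages into one factor per component, so that the
    Patankar term is [Z] applied to [z] times this factor. *)
Definition patankar_weight y y1 : 'cV[R]_N :=
  \col_i (y1 i 0 `^ (- s) * (y i 0 `^ (s - 1)
            * (beta20 alpha beta * y i 0 + beta21 beta * y1 i 0))).

Lemma patankar_termE y y1 z :
  dt *: (A *m diag_mx z^T *m diag_pow y1 (- s) *m diag_pow y (s - 1)
         *m (beta20 alpha beta *: y + beta21 beta *: y1))
  = Z *m hadamard z (patankar_weight y y1).
Proof.
rewrite -!mulmxA scalemxAl; congr (_ *m _); apply/matrixP => i j.
by rewrite !mul_diag_mx !mxE (ord1 j).
Qed.

Let k := beta21 beta - s * a.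

(** The choice of [s] enters here: it makes the slope of the weights produce exactly the coefficient
    of z^2 in P. *)
Lemma weight_slopeE : k * beta = c.
Proof.
rewrite /k /s /c /sspmprk2_s /beta21 -/a; move: (gt_eqF a_gt0) (gt_eqF beta_gt0).
by rewrite /a => a0 b0; field; rewrite b0 a0.
Qed.

Lemma weight_sumE : beta20 alpha beta + beta21 beta = a.
Proof. by rewrite /beta20 /beta21 /a; ring. Qed.

(** Split the weight as [a] plus deviation. To first order the deviation times [y0] is
    [k *: (y1 - y) = (k * beta) *: (Z *m x)], which yields the quadratic term of P; the rest is the
    remainder. *)
Lemma step_errorE y0 y y1 z :
  let d := patankar_weight y y1 in
  let e := z - y0 in let x := y1 - y0 in
  Z *m y0 = 0 -> y1 = y + beta *: (Z *m y1) ->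
  z = (1 - alpha) *: y + alpha *: y1 + Z *m hadamard z d ->
  e - a *: (Z *m e) = x + (1 - a - beta) *: (Z *m x) + c *: (Z *m (Z *m x))
    + Z *m \col_i ((d i 0 - a) * e i 0
                   + ((d i 0 - a) * y0 i 0 - k * (y1 i 0 - y i 0))).
Proof.
move=> d e x Zy0 y1E zE.
have Zx : Z *m y1 = Z *m x by rewrite mulmxBr Zy0 subr0.
set r := (\col_i _).
have dE : hadamard z d = a *: e + a *: y0 + r + (k * beta) *: (Z *m x).
  have -> : (k * beta) *: (Z *m x) = k *: (y1 - y).
    by rewrite -scalerA -Zx; congr (_ *: _); rewrite {2}y1E addrC addKr.
  apply/matrixP => i j; rewrite /r /e; clearbody d; rewrite !mxE (ord1 j); ring.
have eE : e = (1 - alpha) *: y + alpha *: y1 + Z *m hadamard z d - y0.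
  by rewrite {1}/e {1}zE.
have xE : y1 = x + y0 by rewrite subrK.
have yE : y = y1 - beta *: (Z *m x) by rewrite -Zx {1}y1E addrK.
clearbody e x r.
rewrite {1}eE dE !mulmxDr -!scalemxAr Zy0 scaler0 addr0 weight_slopeE yE xE.
move: (Z *m (Z *m x)) (Z *m x) (Z *m e) (Z *m r) => zzx zx ze zr.
apply/matrixP => i j; rewrite !mxE /a; ring.
Qed.

(* The linear part of the error equation is (1 - a Z) e = P(Z) x with
   x = (1 - beta Z)^-1 (y - y0), i.e. e = R(Z) (y - y0). *)
Lemma sspmprk2_local : exists2 K, 0 <= K & forall eta, 0 < eta ->
  exists2 nu, 0 < nu & forall y, sqn w (y - w) <= nu ->
  let z := sspmprk2 alpha beta A dt y in
  sqn w (z - w) <= K * sqn w (y - w) /\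
  forall y0, Z *m y0 = 0 -> sqn w (y0 - w) <= nu ->
  let e := z - y0 in
  exists x r, [/\ y - y0 = x - beta *: (Z *m x),
    e - a *: (Z *m e) = x + (1 - a - beta) *: (Z *m x) + c *: (Z *m (Z *m x)) + Z *m r
    & sqn w r <= eta * (sqn w e + sqn w (y - y0))].
Proof.
have [KZ KZ0 hZ] := sqn_mulmx_le w w_gt0 Z.
have [KP KP0 hP] := sqn_mulmx_le w w_gt0 (1%:M + (1 - a - beta) *: Z + c *: (Z *m Z)).
have [mu mu0 hmu] := sqn_near w w_gt0.
pose K := 4 * KP + 1.
have K0 : 0 < K by rewrite /K; lra.
exists K; first exact: ltW.
move=> eta eta0.
(* With [KZ * eta' <= 1 / 4], the remainder can be absorbed into the left side when [z - w] is
   bounded; this leads to [K = 4 * KP + 1]. *)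
pose eta' := Num.min eta (4 * KZ + 4)^-1.
have KZ4 : 0 < 4 * KZ + 4 by lra.
have eta'0 : 0 < eta' by rewrite lt_min eta0 invr_gt0.
have [eta1 eta2] : eta' <= eta /\ eta' * (4 * KZ + 4) <= 1.
  by rewrite -ler_pdivlMr// div1r /eta' !ge_min !lexx orbT.
have B0 : 0 <= beta ^+ 2 * KZ by rewrite mulr_ge0 ?sqr_ge0.
pose E := 2 * (1 + beta ^+ 2 * KZ) + eta'.
have E0 : 0 < E by rewrite /E; lra.
(* Tolerance for the weights: [et <= 1] gives [et ^+ 2 <= et], and [etE] keeps both parts of the
   remainder together below [eta']. *)
pose et := eta' / E.
have et0 : 0 < et by rewrite divr_gt0.
have et1 : et <= 1 by rewrite ler_pdivrMr// /E; lra.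
have etE : et * (2 * (1 + beta ^+ 2 * KZ)) <= eta'.
  have : et * E = eta' by rewrite divfK ?gt_eqF.
  have : 0 <= et * eta' by rewrite mulr_ge0// ltW.
  rewrite /E; lra.
have et2 : et ^+ 2 <= et by rewrite expr2 -[leRHS]mulr1 ler_pM2l.
have [r /andP[r0 r2] hr] :=
  patankar_weight_estimate R s _ _ a k et weight_sumE erefl et0.
(* Division by [K] keeps the new iterate, and not only [y], within relative distance [r] of [w],
   hence positive. *)
exists (mu * r ^+ 2 / K); first by rewrite divr_gt0// mulr_gt0// exprn_gt0.
have nuK t : t <= mu * r ^+ 2 / K -> K * t <= mu * r ^+ 2.
  by rewrite ler_pdivlMr// mulrC.
have nu1 t : 0 <= t -> t <= mu * r ^+ 2 / K -> t <= mu * r ^+ 2.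
  move=> t0 /nuK; apply: le_trans; rewrite -[leLHS]mul1r ler_wpM2r// /K; lra.
have near x : sqn w (x - w) <= mu * r ^+ 2 -> forall i, `|x i 0 - w i 0| <= r * w i 0.
  by move=> xr i; have := hmu _ _ (ltW r0) xr i; rewrite !mxE.
move=> y ynu /=; set g := sspmprk2 _ _ _ _ y.
have U1 : 1%:M - beta *: Z \in unitmx.
  apply: unitmx_injective => x; rewrite mulmxBl mul1mx -scalemxAl => x0.
  by apply: (sqn_le0 w w_gt0); rewrite (le_trans (sqn_leZ _ _ (ltW beta_gt0)))// x0 sqn0.
pose y1 := invmx (1%:M - beta *: Z) *m y.
have y1P x : x = y + beta *: (Z *m x) <-> x = y1.
  split=> [xE|->].
    rewrite /y1; have -> : y = (1%:M - beta *: Z) *m x.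
      by rewrite mulmxBl mul1mx -scalemxAl {1}xE addrK.
    by rewrite mulKmx.
  have := mulKVmx U1 y; rewrite -/y1 mulmxBl mul1mx -scalemxAl => y1E.
  by rewrite -[in RHS]y1E subrK.
have y1E := (y1P y1).2 erefl.
have x1E y0 : Z *m y0 = 0 -> y - y0 = (y1 - y0) - beta *: (Z *m (y1 - y0)).
  by move=> Zy0; rewrite mulmxBr Zy0 subr0 {1}y1E addrAC addrK.
have x1le y0 : Z *m y0 = 0 -> sqn w (y1 - y0) <= sqn w (y - y0).
  by move=> Zy0; rewrite (x1E _ Zy0); exact/sqn_leZ/ltW.
have ynear := near _ (nu1 _ (sqn_ge0 w w_gt0 _) ynu).
have y1near := near _ (le_trans (x1le _ Zw) (nu1 _ (sqn_ge0 w w_gt0 _) ynu)).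
have stageE : sspmprk2_stage beta A dt y = y1.
  have eqZ x : (beta * dt) *: (A *m x) = beta *: (Z *m x).
    by rewrite -scalemxAl scalerA.
  apply: unique_positive_elementE => /=; first exact: near_gt0 w w_gt0 _ _ r2 y1near.
    by rewrite eqZ; exact: y1E.
  by move=> x; rewrite eqZ => /y1P.
pose d := patankar_weight y y1.
have da i : `|d i 0 - a| <= et.
  have wi : `|w i 0 - w i 0| <= r * w i 0.
    by rewrite subrr normr0 mulr_ge0 ?(ltW r0) ?(ltW (w_gt0 i)).
  by rewrite mxE; exact: proj1 (hr _ _ _ _ (w_gt0 i) wi (ynear i) (y1near i)).
have KZet : KZ * et ^+ 2 < 1.
  have : KZ * et ^+ 2 <= KZ * et by rewrite ler_wpM2l.
  have : 0 <= et * (beta ^+ 2 * KZ) by rewrite mulr_ge0// ltW.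
  have : 0 <= KZ * (et * (beta ^+ 2 * KZ)) by do 2 rewrite mulr_ge0// ?(ltW et0)//.
  have : KZ * (et * (2 * (1 + beta ^+ 2 * KZ))) <= KZ * eta' by rewrite ler_wpM2l.
  lra.
(* A perturbation of [1 - a Z]: a kernel vector [f] satisfies
   [f - a *: (Z *m f) = Z *m ((d - a) f)], and [KZet] forces [f = 0]. *)
have U2 : 1%:M - Z *m diag_mx d^T \in unitmx.
  apply: unitmx_injective => f; rewrite mulmxBl mul1mx -mulmxA mul_diag_col => f0.
  have fE : f - a *: (Z *m f) = Z *m \col_i ((d i 0 - a) * f i 0).
    have -> : \col_i ((d i 0 - a) * f i 0) = hadamard d f - a *: f.
      by apply/matrixP => i j; rewrite !mxE (ord1 j); ring.
    by rewrite mulmxBr -scalemxAr; move/eqP: f0; rewrite subr_eq0 => /eqP <-.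
  apply: (sqn_le0 w w_gt0).
  have h1 := sqn_leZ a f (ltW a_gt0); rewrite fE in h1.
  have h2 := hZ (\col_i ((d i 0 - a) * f i 0)).
  have h3 : sqn w (\col_i ((d i 0 - a) * f i 0)) <= et ^+ 2 * sqn w f.
    by apply: sqn_le_coord => // i; rewrite mxE normrM ler_wpM2r.
  have h4 := le_trans h1 (le_trans h2 (ler_wpM2l KZ0 h3)).
  have : (1 - KZ * et ^+ 2) * sqn w f <= 0 by lra.
  by rewrite pmulr_rle0// subr_gt0.
pose z := invmx (1%:M - Z *m diag_mx d^T) *m ((1 - alpha) *: y + alpha *: y1).
have hadC x : hadamard x d = diag_mx d^T *m x.
  by rewrite mul_diag_col; apply/matrixP => i j; rewrite !mxE mulrC.
have zP x : x = (1 - alpha) *: y + alpha *: y1 + Z *m hadamard x d <-> x = z.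
  rewrite hadC mulmxA; split=> [xE|->].
    rewrite /z; have -> : (1 - alpha) *: y + alpha *: y1 = (1%:M - Z *m diag_mx d^T) *m x.
      by rewrite mulmxBl mul1mx {1}xE addrK.
    by rewrite mulKmx.
  have := mulKVmx U2 ((1 - alpha) *: y + alpha *: y1).
  by rewrite -/z mulmxBl mul1mx => <-; rewrite subrK.
have zE := (zP z).2 erefl.
have est y0 : Z *m y0 = 0 -> sqn w (y0 - w) <= mu * r ^+ 2 / K ->
  let e := z - y0 in let x := y1 - y0 in
  exists2 rr,
    e - a *: (Z *m e) = x + (1 - a - beta) *: (Z *m x) + c *: (Z *m (Z *m x)) + Z *m rr
    & sqn w rr <= eta' * (sqn w e + sqn w (y - y0)).
  move=> Zy0 y0nu e x; rewrite (step_errorE y0 y y1 z Zy0 y1E zE) -/e -/x -/d.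
  eexists; first reflexivity.
  pose q1 := \col_i ((d i 0 - a) * e i 0).
  pose q2 := \col_i ((d i 0 - a) * y0 i 0 - k * (y1 i 0 - y i 0)).
  set rr := (\col_i _); have -> : rr = q1 + q2 by apply/matrixP => i j; rewrite !mxE.
  have b1 : sqn w q1 <= et ^+ 2 * sqn w e.
    by apply: sqn_le_coord => // i; rewrite mxE normrM ler_wpM2r.
  have b2 : sqn w q2 <= et ^+ 2 * sqn w (y1 - y).
    apply: sqn_le_coord => // i; rewrite mxE.
    have y0near := near _ (nu1 _ (sqn_ge0 w w_gt0 _) y0nu).
    have := proj2 (hr _ _ _ _ (w_gt0 i) (y0near i) (ynear i) (y1near i)).
    by rewrite !mxE.
  have b3 : sqn w (y1 - y) <= beta ^+ 2 * KZ * sqn w (y - y0).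
    have -> : y1 - y = beta *: (Z *m x).
      by rewrite mulmxBr Zy0 subr0 {1}y1E addrC addKr.
    rewrite sqnZ -mulrA ler_wpM2l ?sqr_ge0// (le_trans (hZ _))// ler_wpM2l//.
    exact: x1le.
  have b4 := sqnD_le2 w w_gt0 q1 q2.
  have e0 := sqn_ge0 w w_gt0 e; have d0 := sqn_ge0 w w_gt0 (y - y0).
  have b5 : et ^+ 2 * sqn w (y1 - y) <= et ^+ 2 * (beta ^+ 2 * KZ * sqn w (y - y0)).
    by rewrite ler_wpM2l ?sqr_ge0.
  have b6 : et ^+ 2 * (sqn w e + beta ^+ 2 * KZ * sqn w (y - y0)) <=
            et * (sqn w e + beta ^+ 2 * KZ * sqn w (y - y0)).
    by rewrite ler_wpM2r// addr_ge0// mulr_ge0.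
  have b7 : et * (2 * (1 + beta ^+ 2 * KZ)) * (sqn w e + sqn w (y - y0))
            <= eta' * (sqn w e + sqn w (y - y0)) by rewrite ler_wpM2r// addr_ge0.
  have b8 : 0 <= et * (beta ^+ 2 * KZ * sqn w e) by do 2 rewrite mulr_ge0// ?(ltW et0)//.
  have b9 : 0 <= et * sqn w (y - y0) by rewrite mulr_ge0// ltW.
  lra.
have sqnww : sqn w (w - w) <= mu * r ^+ 2 / K.
  by rewrite subrr sqn0 divr_ge0 ?(ltW K0)// mulr_ge0 ?sqr_ge0// ltW.
have zw : sqn w (z - w) <= K * sqn w (y - w).
  have [rr eE hrr] := est w Zw sqnww.
  have h1 := sqn_leZ a (z - w) (ltW a_gt0); rewrite eE in h1.
  have h2 := le_trans h1 (sqnD_le2 w w_gt0 _ _).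
  have h3 := hZ rr.
  have h4 : sqn w (y1 - w + (1 - a - beta) *: (Z *m (y1 - w))
                   + c *: (Z *m (Z *m (y1 - w)))) <= KP * sqn w (y - w).
    have := hP (y1 - w); rewrite !mulmxDl mul1mx -(scalemxAl _ Z) -(scalemxAl c).
    rewrite -mulmxA => /le_trans; apply.
    by rewrite ler_wpM2l// x1le.
  have h5 : KZ * sqn w rr <= KZ * (eta' * (sqn w (z - w) + sqn w (y - w))).
    by rewrite ler_wpM2l.
  have e0 := sqn_ge0 w w_gt0 (z - w); have d0 := sqn_ge0 w w_gt0 (y - w).
  have h6 : eta' * (4 * KZ + 4) * (sqn w (z - w) + sqn w (y - w))
            <= 1 * (sqn w (z - w) + sqn w (y - w)) by rewrite ler_wpM2r// addr_ge0.
  have h7 : 0 <= eta' * (sqn w (z - w) + sqn w (y - w)).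
    by rewrite mulr_ge0 ?addr_ge0// ltW.
  rewrite /K; lra.
have gz : g = z.
  rewrite /g /sspmprk2 stageE -/s; apply: unique_positive_elementE => /=.
  - exact: near_gt0 w w_gt0 _ _ r2 (near _ (le_trans zw (nuK _ ynu))).
  - by rewrite patankar_termE; exact: zE.
  - by move=> x; rewrite patankar_termE => /zP.
rewrite gz; split=> // y0 Zy0 y0nu; have [rr eE hrr] := est y0 Zy0 y0nu.
exists (y1 - y0), rr; split=> //; first exact: x1E.
by apply: le_trans hrr _; rewrite ler_wpM2r// addr_ge0// sqn_ge0.
Qed.

(** The local bound at [y = w] has right-hand side 0. *)
Lemma sspmprk2_steady : sspmprk2 alpha beta A dt w = w.
Proof.
have [K K0 /(_ 1 ltr01)[nu nu0 /(_ w)]] := sspmprk2_local.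
rewrite subrr sqn0 => /(_ (ltW nu0)) /= [+ _]; rewrite mulr0.
by move=> /(sqn_le0 w w_gt0)/eqP; rewrite subr_eq0 => /eqP.
Qed.

(** * Contraction towards the kernel and Lyapunov stability *)

Hypothesis alpha_beta_half : alpha * beta <= 1 / 2.

Let beta_ge_half : 1 / 2 <= beta.
Proof.
have : 1 / (2 * beta) <= 1.
  by apply: le_trans alpha_beta; rewrite lerDr mulr_ge0// ltW.
rewrite ler_pdivrMr ?mulr_gt0//; lra.
Qed.

(** With [u] the solution of [u - a *: (Z *m u) = x], [y - y0] is Q(Z) u, and the new error differs
    from P(Z) u by a resolvent applied to [Z *m r]. The strict contraction leaves room for this
    difference. *)
Lemma sspmprk2_contraction : exists2 nu, 0 < nu & forall y y0 t,
  sqn w (y - w) <= nu -> sqn w (y0 - w) <= nu -> Z *m y0 = 0 -> y - y0 = Z *m t ->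
  let z := sspmprk2 alpha beta A dt y in
  sqn w (z - y0) <= sqn w (y - y0) /\ exists t', z - y0 = Z *m t'.
Proof.
have a_ge : 1 / 2 <= a by have := alpha_beta_half; rewrite /a; lra.
have a0 := ltW a_gt0.
have h0 : 0 <= a + beta - 1 / 2 by have := beta_ge_half; lra.
have g0 : 0 <= 2 * (a * beta) - (a + beta - 1 / 2).
  have : 0 <= (a - 1 / 2) * (beta - 1 / 2) by rewrite mulr_ge0// subr_ge0.
  lra.
have [rho /andP[rho0 rho1] hrho] :=
  stability_contraction w w_gt0 Z Z_metzler Z_conservative Zw a beta h0 g0.
have [KZ KZ0 hZ] := sqn_mulmx_le w w_gt0 Z.
have [K K0 hloc] := sspmprk2_local.
(* [th] raises the contraction factor to at most [(1 + rho) / 2]; [eta] then limits the remainder to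
   a share [(1 - rho) / 4] of both errors. *)
pose th := (1 - rho) / 2.
have th0 : 0 < th by rewrite /th; lra.
pose T := (1 + th^-1) * KZ.
have T0 : 0 <= T by rewrite mulr_ge0// addr_ge0// invr_ge0 ltW.
pose eta := (1 - rho) / 4 / (T + 1).
have T1 : 0 < T + 1 by lra.
have eta0 : 0 < eta by rewrite divr_gt0//; lra.
have etaT : T * eta <= (1 - rho) / 4.
  have : (T + 1) * eta = (1 - rho) / 4 by rewrite mulrC divfK// gt_eqF.
  lra.
have [nu nu0 hnu] := hloc eta eta0.
exists nu => // y y0 t ynu y0nu Zy0 yt z.
have [_ /(_ y0 Zy0 y0nu)/=[x [r [dE eE hr]]]] := hnu y ynu.
rewrite -/z in eE hr; rewrite /c in eE; set e := z - y0 in eE hr *.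
have xE : x = Z *m (t + beta *: x).
  by rewrite mulmxDr -yt dE -scalemxAr subrK.
split; last first.
  exists (t + beta *: x + a *: e + (1 - a - beta) *: x
          + (a * beta - (a + beta) + 1 / 2) *: (Z *m x) + r).
  rewrite -[LHS](subrK (a *: (Z *m e))) eE.
  rewrite {1}xE; clearbody e; rewrite !mulmxDr -!scalemxAr.
  move: (Z *m (Z *m x)) (Z *m x) (Z *m e) (Z *m r) (Z *m t) => v1 v2 v3 v4 v5.
  by apply/matrixP => i j; rewrite !mxE; ring.
have U : 1%:M - a *: Z \in unitmx.
  apply: unitmx_injective => v; rewrite mulmxBl mul1mx -(scalemxAl a) => v0.
  by apply: (sqn_le0 w w_gt0); rewrite (le_trans (sqn_leZ _ _ a0))// v0 sqn0.
pose u := invmx (1%:M - a *: Z) *m x.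
have ux : u - a *: (Z *m u) = x.
  by have := mulKVmx U x; rewrite -/u mulmxBl mul1mx -(scalemxAl a).
have uZ : u = Z *m (t + beta *: x + a *: u).
  by rewrite mulmxDr -xE -(scalemxAr a) -{1}ux subrK.
have QE : y - y0 = u - (a + beta) *: (Z *m u) + (a * beta) *: (Z *m (Z *m u)).
  rewrite dE -ux mulmxBr -(scalemxAr a).
  move: (Z *m (Z *m u)) (Z *m u) => v1 v2.
  by apply/matrixP => i j; rewrite !mxE; ring.
have := hrho _ _ uZ; rewrite -QE; set Pu := u + _ + _ => hPu.
have eP : (e - Pu) - a *: (Z *m (e - Pu)) = Z *m r.
  have -> : Z *m r = e - a *: (Z *m e) - (x + (1 - a - beta) *: (Z *m x)
      + (a * beta - (a + beta) + 1 / 2) *: (Z *m (Z *m x))) by rewrite eE addrC addKr.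
  rewrite -ux /Pu; clearbody e u; rewrite !(mulmxDr, mulmxN) -!scalemxAr.
  move: (Z *m (Z *m (Z *m u))) (Z *m (Z *m u)) (Z *m u) (Z *m e) => v0 v1 v2 v3.
  apply/matrixP => i j; rewrite !mxE; ring.
have h1 : sqn w (e - Pu) <= KZ * sqn w r.
  by rewrite (le_trans (sqn_leZ _ _ a0))// eP.
have h2 := sqnD_le w w_gt0 th Pu (e - Pu) th0; rewrite subrKC in h2.
have e0 := sqn_ge0 w w_gt0 e; have d0 := sqn_ge0 w w_gt0 (y - y0).
have h3 : (1 + th) * sqn w Pu <= (1 + th) * (rho * sqn w (y - y0)).
  by rewrite ler_wpM2l// addr_ge0// ltW.
have h4 : (1 + th^-1) * sqn w (e - Pu) <= T * (eta * (sqn w e + sqn w (y - y0))).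
  rewrite -mulrA ler_wpM2l ?addr_ge0 ?invr_ge0 ?(ltW th0)// (le_trans h1)//.
  by rewrite ler_wpM2l.
have h5 : T * eta * (sqn w e + sqn w (y - y0))
    <= (1 - rho) / 4 * (sqn w e + sqn w (y - y0)) by rewrite ler_wpM2r// addr_ge0.
have h6 : (1 + th) * rho <= (1 + rho) / 2.
  have : 0 <= (1 - rho) * (1 - rho) by rewrite mulr_ge0// subr_ge0 ltW.
  rewrite /th; lra.
have h7 : (1 + th) * rho * sqn w (y - y0) <= (1 + rho) / 2 * sqn w (y - y0).
  by rewrite ler_wpM2r.
(* Both sides carry the same factor because [(1 + rho) / 2 + (1 - rho) / 4 = 1 - (1 - rho) / 4]. *)
have h8 : (1 - (1 - rho) / 4) * sqn w e <= (1 - (1 - rho) / 4) * sqn w (y - y0) by lra.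
by move: h8; rewrite ler_pM2l//; lra.
Qed.

Lemma sspmprk2_lyapunov_stable : lyapunov_stable (sspmprk2 alpha beta A dt) w.
Proof.
move=> eps eps0; have [nu1 nu10 hnu1] := sspmprk2_contraction.
have [nu2 nu20 hnu2] := norm_lt_sqn w w_gt0 eps eps0.
have [_ [C ZC]] := mulmx_sqr_factor w w_gt0 Z Z_metzler Z_conservative Zw.
have [KC KC0 hC] := sqn_mulmx_le w w_gt0 (Z *m C).
have [KN KN0 hN] := sqn_le_norm w w_gt0.
pose nu := Num.min nu1 nu2.
have nu0 : 0 < nu by rewrite lt_min nu10.
(* The first factor covers [2 * sqn w d + 2 * sqn w (y0 - w)], the second the passage to the sup
   norm; [delta <= 1] replaces the squared norm by the norm. *)
pose K := (4 * KC + 2 * (1 + KC) * 2 + 1) * (KN + 1).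
have K0 : 0 < K by rewrite mulr_gt0//; lra.
exists (Num.min 1 (nu / K)); first by rewrite lt_min ltr01 divr_gt0.
move=> y _; rewrite lt_min => /andP[y1 yK] n.
(* Z C is the projection on the range of Z along its kernel. *)
pose x := y - w; pose d := Z *m C *m x; pose y0 := w + (x - d).
have xnu : (4 * KC + 2 * (1 + KC) * 2 + 1) * sqn w x <= nu.
  have x1 : `|x| ^+ 2 <= `|x| by rewrite expr2 -[leRHS]mulr1 ler_wpM2l// ltW.
  have : sqn w x <= (KN + 1) * `|x|.
    rewrite (le_trans (hN _))// ler_pM ?sqr_ge0//; lra.
  move: yK; rewrite ltr_pdivlMr// -/x /K => xK.
  have KC1 : 0 <= 4 * KC + 2 * (1 + KC) * 2 + 1 by lra.
  move=> /(ler_wpM2l KC1); lra.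
have x0 := sqn_ge0 w w_gt0 x.
have KCx : 0 <= KC * sqn w x by rewrite mulr_ge0.
have dx : sqn w d <= KC * sqn w x by exact: hC.
have kx : sqn w (y0 - w) <= 2 * (1 + KC) * sqn w x.
  have := sqnD_le2 w w_gt0 x (- d); rewrite sqnN /y0 [w + _]addrC addrK; lra.
have Zy0 : Z *m y0 = 0.
  by rewrite mulmxDr Zw add0r mulmxBr mulmxA mulmxA -ZC subrr.
have near v : sqn w (v - y0) <= sqn w d -> sqn w (v - w) <= nu.
  move=> vd; have := sqnD_le2 w w_gt0 (v - y0) (y0 - w); rewrite subrKA; lra.
have nunu1 : nu <= nu1 by rewrite ge_min lexx.
have nunu2 : nu <= nu2 by rewrite ge_min lexx orbT.
have y0nu : sqn w (y0 - w) <= nu1 by apply: le_trans nunu1; lra.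
(* The induction follows the distance to [y0], which never grows, together with membership in [y0]
   plus the range of [Z]. *)
suff [+ _] : sqn w (iter n (sspmprk2 alpha beta A dt) y - y0) <= sqn w d /\
    exists t, iter n (sspmprk2 alpha beta A dt) y - y0 = Z *m t.
  by move=> /near vnu; apply: hnu2; exact: le_trans nunu2.
elim: n => [|n [vd [t vt]]] /=.
  have yd : y - y0 = d by rewrite /y0 opprD addrA -/x opprB addrC subrK.
  by rewrite yd; split=> //; exists (C *m x); rewrite mulmxA.
have [h ht] := hnu1 _ y0 t (le_trans (near _ vd) nunu1) y0nu Zy0 vt.
by split=> //; exact: le_trans vd.
Qed.

End StepMap.

(** * Boundedness of the stability region *)

Section Region.
Local Open Scope complex_scope.
Local Open Scope ring_scope.

(** Cleared of denominators, the bound on the stability function gives [k * n ^+ 2 <= L * n + 4] for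
    [n] the modulus of [z], with [k > 0]. *)
Lemma stability_region_bounded (R : realType) (alpha beta : R) :
  0 <= alpha -> 0 < beta -> alpha * beta + 1 / (2 * beta) <= 1 ->
  1 / (2 * beta) < alpha -> bounded_set (stability_region alpha beta).
Proof.
move=> alpha0 beta0 ab1; rewrite ltr_pdivrMr ?mulr_gt0// => ab2.
have b0 : 0 < 2 * beta by rewrite mulr_gt0.
have i0 : 0 < 1 / (2 * beta) by rewrite divr_gt0.
have ab3 : alpha * beta < 1 by apply: lt_le_trans ab1; rewrite ltrDl.
have b1 : 1 < 2 * beta.
  have : 1 / (2 * beta) < 1 by apply: lt_le_trans ab1; rewrite ltrDr; lra.
  by rewrite ltr_pdivrMr// mul1r.
pose m := 2 * alpha * beta ^+ 2 - 2 * alpha * beta + 1.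
pose a := 1 - alpha * beta.
pose q := 2 * beta * (alpha - 1).
pose k := m - 2 * (a * beta).
have k0 : 0 < k.
  have -> : k = (2 * (alpha * beta) - 1) * (2 * beta - 1) by rewrite /k /m /a; ring.
  by rewrite mulr_gt0// subr_gt0//; lra.
have a0 : 0 < a by rewrite subr_gt0.
have m0 : 0 < m.
  have : 0 < a * beta by rewrite mulr_gt0.
  move: k0; rewrite /k; lra.
pose L := `|q| + 2 * (a + beta).
have L0 : 0 <= L by rewrite addr_ge0// mulr_ge0// addr_ge0// ltW.
pose B := 1 + (L + 4) / k.
exists B%:C; split; first by rewrite complex_real.
move=> M /ltW BM z [/= Rez Sz]; apply: le_trans BM.
pose n := complex.Re `|z|.
have nE : `|z| = n%:C by rewrite RRe_real// normr_real.
have n0 : 0 <= n by rewrite -(@ler0c R) -nE.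
(* Division by zero yields 0, so a pole would count as a point of the region; both factors are
   nonzero because their real parts are at least 1 and at most -1. *)
have D1 : (1 - a%:C * z) != 0.
  apply/eqP => /(congr1 (@complex.Re R)).
  have : a * complex.Re z <= 0 by rewrite pmulr_rle0.
  by case: z {Sz nE n n0} Rez => x y /=; rewrite !mul0r subr0; lra.
have D2 : (beta%:C * z - 1) != 0.
  apply/eqP => /(congr1 (@complex.Re R)).
  have : beta * complex.Re z <= 0 by rewrite pmulr_rle0.
  by case: z {Sz D1 nE n n0} Rez => x y /=; rewrite !mul0r subr0; lra.
have PQ : m * n ^+ 2 - `|q| * n - 2 <= 2 * (1 + a * n) * (beta * n + 1).
  have normR (x : R) : `|x%:C| = `|x|%:C by rewrite normc_def /= expr0n addr0 sqrtr_sqr.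
  have norm2 : `|2 : R[i]| = 2%:C by rewrite rmorph_nat normr_nat.
  move: Sz; rewrite /stability_function.
  have -> : 2 * alpha%:C * beta%:C ^+ 2 - 2 * alpha%:C * beta%:C + 1 = m%:C.
    by rewrite /m rmorphD rmorphB 2!rmorphM rmorphXn !rmorphM rmorph_nat rmorph1.
  have -> : 2 * beta%:C * (alpha%:C - 1) = q%:C.
    by rewrite /q !rmorphM rmorphB rmorph_nat rmorph1.
  have -> : 1 + (alpha%:C * beta%:C - 1) * z = 1 - a%:C * z.
    by rewrite /a rmorphB rmorph1 rmorphM; ring.
  set P := - 2 + _ - _; clear k k0 L L0 B; clearbody m a q.
  rewrite normf_div ler_pdivrMr ?mul1r; last first.
    by rewrite normr_gt0 !mulf_neq0// pnatr_eq0.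
  rewrite !normrM norm2 => PQ.
  rewrite -(@lecR R) !(rmorphD, rmorphB, rmorphM, rmorphN, rmorph1) /=.
  rewrite -normR -nE.
  have Q1 : `|1 - a%:C * z| <= 1 + a%:C * `|z|.
    by rewrite (le_trans (ler_normB _ _))// normrM normr1 normR (gtr0_norm a0).
  have Q2 : `|beta%:C * z - 1| <= beta%:C * `|z| + 1.
    by rewrite (le_trans (ler_normB _ _))// normrM normr1 normR (gtr0_norm beta0).
  have Q3 : m%:C * `|z| ^+ 2 - `|q%:C| * `|z| - 2 <= `|P|.
    rewrite !lerBlDr.
    have -> : m%:C * `|z| ^+ 2 = `|P + 2 + q%:C * z|.
      have -> : P + 2 + q%:C * z = m%:C * z ^+ 2 by rewrite /P; ring.
      by rewrite normrM normrX normR (gtr0_norm m0).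
    apply: le_trans (ler_normD _ _) _; rewrite normrM lerD2r.
    by apply: le_trans (ler_normD _ _) _; rewrite normr_nat.
  apply: le_trans Q3 (le_trans PQ _).
  by rewrite rmorph_nat ler_pM ?mulr_ge0// ler_wpM2l.
rewrite [leLHS]nE lecR leNgt; apply/negP => nB.
have n1 : 1 < n by apply: le_lt_trans nB; rewrite lerDl divr_ge0 ?(ltW k0)//; lra.
have kn : k + (L + 4) < n * k.
  by move: nB; rewrite /B -(ltr_pM2r k0) mulrDl mul1r divfK ?gt_eqF.
have : (k + (L + 4)) * n < n * k * n by rewrite ltr_pM2r//; lra.
have : k * n ^+ 2 <= L * n + 4 by move: PQ; rewrite /k /L; lra.
have : 0 < k * n by rewrite mulr_gt0//; lra.
clearbody k L; lra.
Qed.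

End Region.

Theorem corollary3p3 (R : realType) (N : nat) (A : 'M[R]_N) (alpha beta : R)
    (ystar : 'cV[R]_N)
    (A_metzler : metzler A)
    (A_conservative : A^T *m (const_mx 1 : 'cV[R]_N) = 0)
    (alpha_ge0 : 0 <= alpha) (alpha_le1 : alpha <= 1)
    (beta_gt0 : 0 < beta)
    (alpha_beta : alpha * beta + 1 / (2 * beta) <= 1)
    (ystar_ker : A *m ystar = 0)
    (ystar_pos : positive_vector ystar) :
  [/\ forall dt : R, 0 < dt -> sspmprk2 alpha beta A dt ystar = ystar,
      1 / (2 * beta) < alpha -> bounded_set (stability_region alpha beta),
      alpha < 1 / (2 * beta) -> (alpha, beta) <> (0, 1 / 2) ->
        forall dt : R, 0 < dt ->
          stable_fixed_point (sspmprk2 alpha beta A dt) ystar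
    & alpha = 1 / (2 * beta) \/ (alpha, beta) = (0, 1 / 2) ->
        (forall lambda : R[i], is_complex_eigenvalue A lambda ->
           lambda != 0 -> complex.Re lambda < 0) ->
        forall dt : R, 0 < dt ->
          stable_fixed_point (sspmprk2 alpha beta A dt) ystar].
Proof.
have beta2 : beta * (1 / (2 * beta)) = 1 / 2 by field; rewrite gt_eqF.
(* Both stability claims reduce to this inequality: it is [alpha <= 1 / (2 * beta)] multiplied by
   [beta], and it is trivial for [alpha = 0]. *)
have stable : alpha * beta <= 1 / 2 -> forall dt : R, 0 < dt ->
    stable_fixed_point (sspmprk2 alpha beta A dt) ystar.
  by move=> half dt dt_gt0; split;
    [exact: sspmprk2_steady | exact: sspmprk2_lyapunov_stable].
split.
- by move=> dt dt_gt0; exact: sspmprk2_steady.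
- exact: stability_region_bounded.
- by move=> alpha_lt _; apply: stable; rewrite mulrC -beta2 ler_pM2l// ltW.
- case=> alphaE _; apply: stable; first by rewrite mulrC alphaE beta2.
  by move/(congr1 fst): alphaE => /= ->; rewrite mul0r divr_ge0.
Qed.
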